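(* Let $d$ be the dimension, $D=\binom{d+1}{2}$, let $G=(V,E)$ be a graph, $R$ a multiset of vertices of $V$, and $b^{\circ}:R\to Gr(2,\mathbb{R}^{d+1})$, $r\mapsto[b^\circ_r]$. Then there exists a bar-configuration $b:E\to Gr(2,\mathbb{R}^{d+1})$ such that the $d$-dimensional body-bar framework with bar-boundary $(G,R;b,b^\circ)$ is minimally infinitesimally rigid if and only if (1) $\{b^\circ_r\mid r\in R_v\}$ is linearly independent for each $v\in V$; (2) $|F|+|R_F|\le D|V(F)|-D+\dim(\{b^\circ_r\mid r\in R_F\})$ for every non-empty $F\subseteq E$; (3) $|E|+|R|=D|V|$.
   Context: Graphs are finite and undirected; $V(F)$ is the set of vertices incident to edges of $F\subseteq E$. The multiset $R$ is an indexed family of vertices (elements with different indices are different elements of $R$); $R_v=\{r\in R\mid r=v\}$ and $R_F=\{r\in R\mid r\in V(F)\}$ as multi-subsets. Families such as $\{b^\circ_r\mid r\in R_v\}$ are indexed families of vectors, and $\dim(\cdot)$ of a family is the dimension of its linear span. $Gr(2,\mathbb{R}^{d+1})$ is the Grassmannian of $2$-dimensional linear subspaces, identified via the Plücker embedding with the set of classes $[v_1\wedge v_2]\in\mathbb{P}(\bigwedge^2\mathbb{R}^{d+1})$ of nonzero decomposable elements; $b_e$ (resp. $b^\circ_r$) denotes a representative vector in $\bigwedge^2\mathbb{R}^{d+1}$ of $b(e)$ (resp. $b^\circ(r)$). For $a\in\bigwedge^{d-1}\mathbb{R}^{d+1}$ and $c\in\bigwedge^2\mathbb{R}^{d+1}$,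 $\langle a,c\rangle$ denotes the standard Euclidean inner product $\langle a,*c\rangle$ of $a$ with the Hodge dual of $c$. A $d$-dimensional body-bar framework with bar-boundary is a tuple $(G,R;b,b^\circ)$ with a bar-configuration $b:E\to Gr(2,\mathbb{R}^{d+1})$, $e\mapsto[b_e]$, and a boundary configuration $b^\circ:R\to Gr(2,\mathbb{R}^{d+1})$. An infinitesimal motion is a map $m:V\to\bigwedge^{d-1}\mathbb{R}^{d+1}$ with $\langle m(u)-m(v),b_e\rangle=0$ for all $e=uv\in E$ and $\langle m(v),b^\circ_r\rangle=0$ for all $v\in V$, $r\in R_v$. The framework is infinitesimally rigid if it has no nonzero infinitesimal motion, and minimally infinitesimally rigid if moreover removing any bar (an edge of $E$ or a boundary-bar, i.e. an element of $R$) results in a framework that is not infinitesimally rigid. *)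

(* Defs.v *)
From HB Require Import structures.
From mathcomp Require Import all_boot all_order all_algebra.
From mathcomp Require Import reals.

Set Implicit Arguments.
Unset Strict Implicit.
Unset Printing Implicit Defensive.

Import GRing.Theory.

Local Open Scope ring_scope.

Definition ksubset (k n : nat) := {A : {set 'I_n} | #|A| == k}.

(* The k-th exterior power of R^n, in coordinates with respect to the basis
   e_A = e_{i1} /\ ... /\ e_{ik}, where A = {i1 < ... < ik}. *)
Definition extpow (R : realType) (k n : nat) := {ffun ksubset k n -> R^o}.

(* [enum_val] lists the elements of a set of ordinals in increasing order. *)
Definition ksubset_nth (k n : nat) (A : ksubset k n) (j : 'I_k) : 'I_n :=
  enum_val (cast_ord (esym (eqP (valP A))) j).

(* The product v_1 /\ ... /\ v_k of the rows of M; its coordinates are the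
   maximal minors of M. *)
Definition wedge (R : realType) (k n : nat) (M : 'M[R]_(k, n)) :
    extpow R k n :=
  [ffun A => \det (colsub (ksubset_nth A) M)].

Definition inversions (n : nat) (A B : {set 'I_n}) : nat :=
  #|[set p : 'I_n * 'I_n | [&& p.1 \in A, p.2 \in B & (p.2 < p.1)%N]]|.

(* The linear map with *e_B = (-1)^(inversions B B^c) e_{B^c}, the sign being
   the one for which e_B /\ *e_B = e_1 /\ ... /\ e_n.  For k <= n the set
   ~: A always has k elements, so the default value 0 is never used. *)
Definition hodge (R : realType) (k n : nat) (c : extpow R k n) :
    extpow R (n - k) n :=
  [ffun A => (-1) ^+ inversions (~: val A) (val A)
               * oapp c 0 (insub (~: val A) : option (ksubset k n))].

Definition inner (R : realType) (k n : nat) (a c : extpow R k n) : R :=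
  \sum_A a A * c A.

Definition pairing (R : realType) (d : nat)
    (a : extpow R (d - 1) d.+1) (c : extpow R 2 d.+1) : R :=
  inner a (hodge c).

Definition Gr (R : realType) (k n : nat) :=
  {U : {vspace 'rV[R]_n} | \dim U == k}.

(* A representative of the image of U under the Pluecker embedding, namely
   the one given by the basis [vbasis U].  By [wedge_plucker] any other basis
   of U gives a nonzero multiple of it. *)
Definition plucker (R : realType) (k n : nat) (U : Gr R k n) : extpow R k n :=
  wedge (\matrix_(i < k) (vbasis (val U))`_i).

Lemma wedge_mull (R : realType) (k n : nat) (P : 'M[R]_k) (M : 'M[R]_(k, n)) :
  wedge (P *m M) = \det P *: wedge M.
Proof.
apply/ffunP => A; rewrite !ffunE.
by rewrite -[RHS]det_mulmx; congr (\det _); apply/matrixP => i j; rewrite !mxE;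
   apply: eq_bigr => l _; rewrite !mxE.
Qed.

Lemma wedge_neq0 (R : realType) (k n : nat) (M : 'M[R]_(k, n)) :
  row_free M -> wedge M != 0.
Proof.
move=> frM.
have fuMt : row_full M^T by rewrite /row_full mxrank_tr.
pose f := fullrankfun fuMt.
have finj : injective f by exact: fullrankfun_inj.
pose S := [set f i | i : 'I_k].
have cS : #|S| == k by rewrite card_imset // card_ord.
pose A : ksubset k n := exist _ S cS.
have fu : row_full (rowsub (ksubset_nth A) M^T).
  rewrite -sub1mx (submx_trans _ (_ : rowsub f M^T <= _)%MS) //.
    by rewrite sub1mx fullrowsub_full.
  apply/row_subP => i; rewrite row_rowsub.
  have fiS : f i \in S by exact: imset_f.
  apply: (eq_row_sub (cast_ord (eqP cS) (enum_rank_in fiS (f i)))).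
  rewrite row_rowsub /ksubset_nth /=; congr row.
  rewrite -[RHS](enum_rankK_in fiS fiS); congr enum_val.
  exact: val_inj.
apply/eqP => /ffunP /(_ A); rewrite !ffunE => /eqP.
apply/negP; rewrite -unitfE -unitmxE -unitmx_tr -row_full_unit.
by rewrite (_ : _^T = rowsub (ksubset_nth A) M^T) //; apply/matrixP => i j; rewrite !mxE.
Qed.

Lemma vbasis_row_free (R : realType) (k n : nat) (U : Gr R k n) :
  row_free (\matrix_(i < k) (vbasis (val U))`_i).
Proof.
case: U => U dU /=; rewrite -kermx_eq0; apply/rowV0P => u /sub_kermxP uB.
have /eqP e := dU; move: u uB; case: _ / e => u uB.
have /freeP/(_ (u 0)) H := basis_free (vbasisP U).
apply/rowP => i; rewrite !mxE; apply: H.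
by rewrite -[RHS]uB mulmx_sum_row; apply: eq_bigr => j _; rewrite rowK.
Qed.

Lemma plucker_neq0 (R : realType) (k n : nat) (U : Gr R k n) : plucker U != 0.
Proof. exact/wedge_neq0/vbasis_row_free. Qed.

Lemma wedge_plucker (R : realType) (k n : nat) (U : Gr R k n)
    (M : 'M[R]_(k, n)) :
  <<[seq row i M | i <- enum 'I_k]>>%VS = val U ->
  exists2 c : R, c != 0 & wedge M = c *: plucker U.
Proof.
move=> MU; set B := \matrix_(i < k) (vbasis (val U))`_i.
pose X := [tuple of [seq row i M | i <- enum 'I_k]].
have Xi (i : 'I_#|'I_k|) : exists j, X`_i = row j M.
  have : X`_i \in X by apply: mem_nth; rewrite size_tuple ltn_ord.
  by case/mapP=> j _ ->; exists j.
have MB : (B <= M)%MS.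
  apply/row_subP => i; rewrite rowK.
  have : (vbasis (val U))`_i \in val U.
    by apply/vbasis_mem/mem_nth; rewrite size_tuple (eqP (valP U)).
  rewrite -MU => /coord_span; move=> ->.
  apply: summx_sub => j _; apply: scalemx_sub.
  by case: (Xi j) => l; rewrite /X /= => ->; apply: row_sub.
case/submxP: MB => Q BQ.
have uQ : Q \in unitmx.
  rewrite -row_free_unit; have := vbasis_row_free U; rewrite -/B BQ.
  rewrite /row_free => /eqP rk; rewrite eqn_leq rank_leq_row /=.
  by rewrite -{1}rk mxrankM_maxl.
exists (\det Q)^-1; first by rewrite invr_neq0 // -unitfE -unitmxE.
by rewrite /plucker -/B BQ wedge_mull scalerK // -unitfE -unitmxE.
Qed.

(* Parallel edges and loops are allowed.  The order of the two endpoints of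
   an edge is irrelevant to all the notions below. *)
Record graph := Graph {
  vertex : finType;
  edge : finType;
  ends : edge -> vertex * vertex
}.

Definition covered (G : graph) (F : {set edge G}) : {set vertex G} :=
  [set v | [exists e in F, (v == (ends e).1) || (v == (ends e).2)]].

(* The multiset of vertices is the family [root] indexed by [bidx]. *)
Record framework (R : realType) (d : nat) := Framework {
  fgraph : graph;
  bidx : finType;
  root : bidx -> vertex fgraph;
  bar : edge fgraph -> Gr R 2 d.+1;
  bbar : bidx -> Gr R 2 d.+1
}.

Definition infinitesimal_motion (R : realType) (d : nat) (P : framework R d)
    (m : vertex (fgraph P) -> extpow R (d - 1) d.+1) : Prop :=
  (forall e : edge (fgraph P),
     pairing (m (ends e).1 - m (ends e).2) (plucker (bar e)) = 0) /\
  (forall r : bidx P, pairing (m (root r)) (plucker (bbar r)) = 0).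

Definition infinitesimally_rigid (R : realType) (d : nat)
    (P : framework R d) : Prop :=
  ~ exists m : vertex (fgraph P) -> extpow R (d - 1) d.+1,
      infinitesimal_motion m /\ exists v, m v != 0.

Definition remove_edge (G : graph) (e : edge G) : graph :=
  @Graph (vertex G) {x : edge G | x != e} (fun x => ends (val x)).

Definition remove_bar (R : realType) (d : nat) (P : framework R d)
    (e : edge (fgraph P)) : framework R d :=
  @Framework R d (remove_edge e) (bidx P) (@root R d P)
    (fun x => bar (val x)) (@bbar R d P).

Definition remove_bbar (R : realType) (d : nat) (P : framework R d)
    (r : bidx P) : framework R d :=
  @Framework R d (fgraph P) {x : bidx P | x != r} (fun x => root (val x))
    (@bar R d P) (fun x => bbar (val x)).

Definition minimally_infinitesimally_rigid (R : realType) (d : nat)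
    (P : framework R d) : Prop :=
  [/\ infinitesimally_rigid P,
      forall e : edge (fgraph P), ~ infinitesimally_rigid (remove_bar e)
    & forall r : bidx P, ~ infinitesimally_rigid (remove_bbar r)].

(* The family of representatives of b r, r \in A; repetitions are kept. *)
Definition bfamily (R : realType) (d : nat) (J : finType)
    (b : J -> Gr R 2 d.+1) (A : {set J}) : seq (extpow R 2 d.+1) :=
  [seq plucker (b r) | r in A].

(* Main.v *)
(* Write W for the exterior square of R^(d+1).  An edge e = uv with bar b gives
   the row carrying b at u and -b at v in W^V, a boundary bar at v gives the row
   carrying it at v, and the framework is minimally rigid iff these rows form a
   basis of W^V.
   Necessity: summing the coordinates over V(F) kills the rows of F, so the rows
   of F and R_F span at most D|V(F)| - D + dim(b_r : r in R_F) dimensions.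
   Sufficiency: the row of e may be chosen among the rows of the coordinate
   planes, which span A_e = {(x at u, -x at v)}.  By Rado's theorem on independent
   transversals it is enough that dim(B + sum of the A_e, e in F) >= |F| + |R| for
   every F, where B is the span of the boundary rows.  That dimension is computed
   separately on each connected component of (V, F): condition (2) bounds the
   components having edges and condition (1) the isolated vertices. *)
From HB Require Import structures.
Require Import Defs.
From mathcomp Require Import all_boot all_order all_algebra.
From mathcomp Require Import reals.
From mathcomp Require Import zify.

Set Implicit Arguments.
Unset Strict Implicit.
Unset Printing Implicit Defensive.

Import GRing.Theory.

(** * Spans and minimal spanning families of vectors *)

Section Families.

Local Open Scope ring_scope.

Variables (K : fieldType) (vT : vectType K).
Implicit Types (I : finType) (N : {vspace vT}).

Lemma span_image I (f : I -> vT) (A : {set I}) :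
  <<[seq f i | i in A]>>%VS = (\sum_(i in A) <[f i]>)%VS.
Proof. by rewrite span_def big_image. Qed.

Lemma dim_sum_lines I (f : I -> vT) (P : pred I) :
  (\dim (\sum_(i | P i) <[f i]>) <= #|[set i | P i]|)%N.
Proof.
apply: leq_trans (dimv_leq_sum _ _ _) _; rewrite -sum1dep_card.
by apply: leq_sum => i _; rewrite dim_vline leq_b1.
Qed.

Lemma addvCA : left_commutative (@addv K vT).
Proof. by move=> N1 N2 N3; rewrite !addvA (addvC N1). Qed.

Lemma dim_addv_line N x : x \notin N -> \dim (<[x]> + N) = (\dim N).+1.
Proof.
move=> xN; have x0 : x != 0 by apply: contraNneq xN => ->; exact: mem0v.
rewrite dimv_disjoint_sum ?dim_vline ?x0 //; apply/eqP; rewrite -subv0.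
apply/subvP => w /memv_capP[/vlineP[k ->]] kxN; rewrite memv0 scaler_eq0.
by apply: contraNT xN => /norP[k0 _]; rewrite -(scalerK k0 x) memvZ.
Qed.

Lemma free_dim_sum_lines I (f : I -> vT) (A : {set I}) :
  {in A, forall i, f i \notin (\sum_(j in A :\ i) <[f j]>)%VS} ->
  \dim (\sum_(i in A) <[f i]>) = #|A|.
Proof.
move: {2}#|A| (leqnn #|A|) => n; elim: n A => [|n IHn] A.
  by rewrite leqn0 cards_eq0 => /eqP-> _; rewrite big_set0 dimv0 cards0.
move=> cA fA; have [->|[i Ai]] := set_0Vmem A.
  by rewrite big_set0 dimv0 cards0.
rewrite (big_setD1 i) //= dim_addv_line ?fA // (cardsD1 i A) Ai IHn //.
  by move: cA; rewrite (cardsD1 i A) Ai.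
move=> j /[dup] /setD1P[ji Aj] Dj; apply: contra (fA j Aj); apply/subvP.
apply/subv_sumP => k /setD1P[kj /setD1P[_ Ak]].
by apply: (sumv_sup k) => //; rewrite in_setD1 kj.
Qed.

Lemma redundant_line I (f : I -> vT) :
  (\dim (\sum_i <[f i]>) < #|I|)%N ->
  exists i, (\sum_i <[f i]> <= \sum_(j | j != i) <[f j]>)%VS.
Proof.
move=> lt; have [/existsP[i fi]|/existsPn nfi] :=
  boolP [exists i, f i \in (\sum_(j | j != i) <[f j]>)%VS].
  exists i; apply/subv_sumP => j _; have [->|ji] := eqVneq j i.
    by rewrite -memvE.
  exact: (sumv_sup j).
have : \dim (\sum_(i in [set: I]) <[f i]>) = #|[set: I]|.
  apply: free_dim_sum_lines => i _; apply: contra (nfi i).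
  by rewrite (eq_bigl (fun j => j != i)) // => j; rewrite !inE andbT.
rewrite cardsT (eq_bigl xpredT) => [e|i]; last by rewrite inE.
by rewrite e ltnn in lt.
Qed.

(** A spanning family larger than the dimension has a redundant member by [redundant_line]; one of
    exactly that size has too few vectors left once a member is dropped. *)
Lemma minimal_spanningP I (f : I -> vT) :
  (\sum_i <[f i]>)%VS = fullv ->
  (forall i, (\sum_(j | j != i) <[f j]>)%VS <> fullv) <-> #|I| = dim vT.
Proof.
move=> ff; split => [min|cI i fi].
  apply/eqP; rewrite eqn_leq andbC -dimvf -ff; apply/andP; split.
    by apply: leq_trans (dim_sum_lines _ _) _; rewrite cardsE.
  rewrite leqNgt; apply/negP => /redundant_line[i].
  by rewrite ff => /(conj (subvf _))/andP/subv_anti/min.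
have := dim_sum_lines f (fun j => j != i); rewrite fi dimvf -cI.
rewrite cardsE cardC1; have := max_card (pred1 i); rewrite card1; lia.
Qed.

(** The subfamily and its complement each span at most their cardinality, yet together they span
    [dim vT = #|I|] dimensions, so both bounds are attained. *)
Lemma dim_subfamily I (f : I -> vT) (P : pred I) :
  (\sum_i <[f i]>)%VS = fullv -> #|I| = dim vT ->
  \dim (\sum_(i | P i) <[f i]>) = #|[set i | P i]|.
Proof.
move=> ff cI; apply/eqP; rewrite eqn_leq dim_sum_lines /=.
have := dim_sum_lines f (predC P).
have := dimv_add_leqif (\sum_(i | P i) <[f i]>) (\sum_(i | ~~ P i) <[f i]>).
rewrite -(bigID P xpredT) /= ff dimvf -cI => -[le _].
rewrite -(cardsC [set i | P i]) in le.
rewrite (_ : [set i | ~~ P i] = ~: [set i | P i]) => [le'|].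
  by rewrite -(leq_add2r #|~: [set i | P i]|) (leq_trans le) ?leq_add2l.
by apply/setP => i; rewrite !inE.
Qed.

End Families.

(** * Rado's theorem on independent transversals, relative to a subspace *)

Section Rado.

Local Open Scope ring_scope.

Variables (K : fieldType) (vT : vectType K) (E X : finType) (B : {vspace vT}).
Variable f : E -> X -> vT.

(* Hall's condition in the quotient by [B]. *)
Definition hall (A : E -> {vspace vT}) :=
  forall F : {set E}, (#|F| + \dim B <= \dim (B + \sum_(e in F) A e))%N.

Definition tight (A : E -> {vspace vT}) (F : {set E}) :=
  \dim (B + \sum_(e in F) A e) == (#|F| + \dim B)%N.

(** Submodularity: the dimensions of the sum and of the intersection of the two spans add up to
    those of the spans. Hall's condition bounds both from below, by the union and the intersection
    of the index sets, which forces equality. *)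
Lemma tightU A F1 F2 : hall A -> tight A F1 -> tight A F2 -> tight A (F1 :|: F2).
Proof.
move=> hA /eqP t1 /eqP t2.
have hU : (\dim (B + \sum_(e in F1 :|: F2) A e) <=
    \dim ((B + \sum_(e in F1) A e) + (B + \sum_(e in F2) A e)))%N.
  apply: dimvS; rewrite subv_add (subv_trans (addvSl _ _) (addvSl _ _)) /=.
  apply/subv_sumP => e /setUP[e1|e2].
    by apply: subv_trans (subv_trans (addvSr _ _) (addvSl _ _)); apply: (sumv_sup e).
  by apply: subv_trans (subv_trans (addvSr _ _) (addvSr _ _)); apply: (sumv_sup e).
have hI : (\dim (B + \sum_(e in F1 :&: F2) A e) <=
    \dim ((B + \sum_(e in F1) A e) :&: (B + \sum_(e in F2) A e)))%N.
  apply: dimvS; rewrite subv_cap !addvS //;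
  by apply/subv_sumP => e /setIP[e1 e2]; apply: (sumv_sup e).
have := dimv_sum_cap (B + \sum_(e in F1) A e) (B + \sum_(e in F2) A e).
have := cardsUI F1 F2; move: (hA (F1 :&: F2)) (hA (F1 :|: F2)); rewrite /tight.
lia.
Qed.

(* Let [F] be the largest tight set avoiding [e].  As [F] together with [e]
   satisfies Hall's condition, some [f e x] lies outside the span of [F]. *)
Lemma hall_step A (e : E) :
  hall A -> (forall N : {vspace vT}, (forall x, f e x \in N) -> (A e <= N)%VS) ->
  exists x, hall (fun e' => if e' == e then <[f e x]>%VS else A e').
Proof.
move=> hA fA; pose S := (\bigcup_(F : {set E} | tight A F && (e \notin F)) F)%SET.
have /andP[tS eS] : tight A S && (e \notin S).
  apply: (big_ind (fun F => tight A F && (e \notin F))) => [|F1 F2 /andP[t1 n1] /andP[t2 n2]|//].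
    by rewrite /tight big_set0 addv0 cards0 in_set0 eqxx.
  by rewrite tightU //= in_setU (negPf n1).
have [/existsP[x xN]|/existsPn nx] :=
  boolP [exists x, f e x \notin (B + \sum_(e' in S) A e')%VS]; last first.
  have AS : (A e <= B + \sum_(e' in S) A e')%VS.
    by apply: fA => x; move: (nx x); rewrite negbK.
  have := hA (e |: S); rewrite big_setU1 //= cardsU1 eS addvCA (addv_idPr AS).
  by rewrite (eqP tS); lia.
exists x => F; have [eF|eF] := boolP (e \in F); last first.
  rewrite (eq_bigr A) ?hA // => e' e'F; case: eqP => // ee'.
  by rewrite -ee' e'F in eF.
rewrite (big_setD1 e) //= eqxx (cardsD1 e) eF (eq_bigr A); last first.
  by move=> e' /setD1P[/negPf->].
rewrite addvCA; have := hA (F :\ e).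
(* If [F :\ e] is not tight, its slack of one pays for [e]. If it is tight, it is contained in [S],
   so [f e x] lies outside its span and adds a dimension. *)
have [tF|] := boolP (tight A (F :\ e)); last first.
  move=> nt; have := dimvS (addvSr <[f e x]> (B + \sum_(e' in F :\ e) A e')).
  by move: nt; rewrite /tight; lia.
rewrite dim_addv_line; first by lia.
apply: contra xN; apply/subvP/addvS => //; apply/subv_sumP => e' e'F.
apply: (sumv_sup e') => //; apply/bigcupP; exists (F :\ e) => //.
by rewrite tF setD11.
Qed.

(** The spaces [A e] are replaced by lines one at a time, [hall_step] preserving Hall's condition.
    The first hypothesis puts [A e] inside the span of the vectors [f e x]; [x0] starts the
    induction. *)
Lemma rado (x0 : X) (A : E -> {vspace vT}) :
  (forall e (N : {vspace vT}), (forall x, f e x \in N) -> (A e <= N)%VS) -> hall A ->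
  exists x : E -> X, hall (fun e => <[f e (x e)]>%VS).
Proof.
move=> fA hA.
suff /(_ (enum E) (enum_uniq E))[x hx] : forall s : seq E, uniq s ->
    exists x : E -> X, hall (fun e => if e \in s then <[f e (x e)]>%VS else A e).
  exists x => F; rewrite (leq_trans (hx F)) // eq_leq //.
  by congr (\dim (_ + _)); apply: eq_bigr => e _; rewrite mem_enum.
elim=> [_|e s IHs /= /andP[es /IHs[x /(hall_step (e := e))]]].
  by exists (fun=> x0).
rewrite (negPf es) => /(_ (fA e))[y hy].
exists (fun e' => if e' == e then y else x e') => F.
rewrite (leq_trans (hy F)) // eq_leq //; congr (\dim (_ + _)).
by apply: eq_bigr => e' _; rewrite inE; case: eqP => [->|].
Qed.

End Rado.

(** * The space of W-valued functions on the vertices *)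

Section VertexSums.

Local Open Scope ring_scope.

Variables (K : fieldType) (W : vectType K) (V : finType).

Definition single_fun (v : V) (w : W) : {ffun V -> W} :=
  [ffun u => if u == v then w else 0].

Fact single_fun_is_linear v : linear (single_fun v).
Proof.
move=> a w w'; apply/ffunP => u; rewrite !ffunE.
by case: eqP => // _; rewrite scaler0 addr0.
Qed.

HB.instance Definition _ v :=
  GRing.isLinear.Build K W {ffun V -> W} *:%R (single_fun v)
    (single_fun_is_linear v).

Definition single v : 'Hom(W, {ffun V -> W}) := linfun (single_fun v).

(** A constant [rho] gives the total sum of the coordinates, and the component root gives the sum
    over each connected component; these are the two uses below. *)
Definition push_fun (rho : V -> V) (x : {ffun V -> W}) : {ffun V -> W} :=
  [ffun v => \sum_(u | rho u == v) x u].

Fact push_fun_is_linear rho : linear (push_fun rho).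
Proof.
move=> a x y; apply/ffunP => v; rewrite !ffunE scaler_sumr -big_split /=.
by apply: eq_bigr => u _; rewrite !ffunE.
Qed.

HB.instance Definition _ rho :=
  GRing.isLinear.Build K {ffun V -> W} {ffun V -> W} *:%R (push_fun rho)
    (push_fun_is_linear rho).

Definition push rho : 'Hom({ffun V -> W}, {ffun V -> W}) :=
  linfun (push_fun rho).

Lemma singleE v w u : single v w u = if u == v then w else 0.
Proof. by rewrite lfunE ffunE. Qed.

Lemma lker_single v : lker (single v) == 0%VS.
Proof.
apply/lker0P => w w' /(congr1 (fun x : {ffun V -> W} => x v)).
by rewrite !singleE eqxx.
Qed.

Lemma dim_limg_single v N : \dim (single v @: N) = \dim N.
Proof. by apply: limg_dim_eq; rewrite (eqP (lker_single v)) capv0. Qed.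

Lemma sum_singleE (P : pred V) (y : V -> W) v :
  (\sum_(u | P u) single u (y u)) v = if P v then y v else 0.
Proof.
rewrite sum_ffunE; case: ifP => Pv.
  rewrite (bigD1 v) //= singleE eqxx big1 ?addr0 // => u /andP[_ uv].
  by rewrite singleE eq_sym (negPf uv).
by rewrite big1 // => u Pu; rewrite singleE; case: eqP Pu => // <-; rewrite Pv.
Qed.

Lemma ffun_sum_single (x : {ffun V -> W}) : x = \sum_v single v (x v).
Proof. by apply/ffunP => v; rewrite (sum_singleE xpredT). Qed.

Lemma push_single rho v w : push rho (single v w) = single (rho v) w.
Proof.
apply/ffunP => u; rewrite lfunE ffunE singleE.
have [->|uv] := eqVneq u (rho v).
  rewrite (bigD1 v) //= singleE eqxx big1 ?addr0 // => u' /andP[_ uv].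
  by rewrite singleE (negPf uv).
rewrite big1 // => u' /eqP e; rewrite singleE.
by case: eqP => // u'v; rewrite -e u'v eqxx in uv.
Qed.

Lemma pushE rho x : push rho x = \sum_v single (rho v) (x v).
Proof.
rewrite {1}[x]ffun_sum_single linear_sum /=.
by apply: eq_bigr => v _; rewrite push_single.
Qed.

Lemma dim_sum_single (P : pred V) (Y : V -> {vspace W}) :
  \dim (\sum_(v | P v) single v @: Y v) = (\sum_(v | P v) \dim (Y v))%N.
Proof.
rewrite (directvP _) /=; first by apply: eq_bigr => v _; rewrite dim_limg_single.
apply/directv_sum_independent => us usY us0 v Pv.
have usE u : P u -> us u = single u (us u u).
  by move=> /usY/memv_imgP[w _ ->]; rewrite singleE eqxx.
rewrite usE //; move: us0; rewrite (eq_bigr (fun u => single u (us u u)) usE).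
move=> /(congr1 (fun x : {ffun V -> W} => x v)); rewrite (sum_singleE P (fun u => us u u)) Pv ffunE => ->.
by rewrite linear0.
Qed.

End VertexSums.

(** * Upper and lower bounds for the span of the rows *)

Section Graphs.

Import fingraph.
Local Open Scope ring_scope.

Variables (K : fieldType) (W : vectType K) (G : graph) (J : finType).
Variables (rt : J -> vertex G) (c : J -> W).

Let V := vertex G.
Let D := dim W.

Definition difference (e : edge G) : 'Hom(W, {ffun V -> W}) :=
  single W (ends e).1 - single W (ends e).2.

Lemma differenceE e w :
  difference e w = single W (ends e).1 w - single W (ends e).2 w.
Proof. by rewrite add_lfunE opp_lfunE. Qed.

(** All rows lie in the functions supported on [X], of dimension [D * #|X|]. Summing coordinates
    into one vertex of [X] maps these onto a copy of [W], so the kernel loses [D] dimensions; edge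
    rows fall in the kernel, and boundary rows have image spanned by the [c r]. *)
Lemma dim_rows_le (b : edge G -> W) (F : {set edge G}) (X : {set V}) :
  X != set0 -> covered F \subset X ->
  (\dim (\sum_(e in F) <[difference e (b e)]>
         + \sum_(r | rt r \in X) <[single W (rt r) (c r)]>) + D
   <= D * #|X| + \dim (\sum_(r | rt r \in X) <[c r]>))%N.
Proof.
move=> /set0Pn[v0 Xv0] cX; set N := (_ + _)%VS.
pose UX := (\sum_(v in X) single W v @: fullv)%VS.
have UXv v w : v \in X -> single W v w \in UX.
  by move=> Xv; apply: (subvP (sumv_sup v Xv (subvv _))); rewrite memv_img ?memvf.
have NUX : (N <= UX)%VS.
  rewrite subv_add; apply/andP; split; apply/subv_sumP.
    move=> e Fe; rewrite -memvE differenceE rpredB ?UXv ?(subsetP cX) //;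
    by rewrite inE; apply/existsP; exists e; rewrite Fe eqxx ?orbT.
  by move=> r Xr; rewrite -memvE UXv.
have dUX : \dim UX = (D * #|X|)%N.
  by rewrite dim_sum_single sum_nat_const dimvf mulnC.
pose p := push W (fun _ : V => v0).
have pN : (\dim (p @: N) <= \dim (\sum_(r | rt r \in X) <[c r]>))%N.
  rewrite -(dim_limg_single v0 (\sum_(r | _) _)%VS) dimvS // limgD subv_add !limg_sum.
  apply/andP; split; apply/subv_sumP.
    by move=> e _; rewrite limg_line differenceE linearB /= !push_single subrr sub0v.
  by move=> r Xr; rewrite limg_line push_single -limg_line (sumv_sup r).
have pUX : (D <= \dim (p @: UX))%N.
  rewrite -[D]dimvf -(dim_limg_single v0) dimvS //; apply/subvP => _ /memv_imgP[w _ ->].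
  by rewrite -(push_single (fun=> v0) v0) memv_img ?UXv.
have := limg_ker_dim p N; have := limg_ker_dim p UX.
have := dimvS (capvS NUX (subvv (lker p))); move: pN pUX dUX.
rewrite /D; lia.
Qed.

Definition adjacent (F : {set edge G}) : rel V := fun u v =>
  [exists e in F, (ends e == (u, v)) || (ends e == (v, u))].

Lemma adjacent_sym (F : {set edge G}) : symmetric (adjacent F).
Proof.
by move=> u v; apply: eq_existsb => e; rewrite orbC.
Qed.

Lemma connect_ends (F : {set edge G}) e : e \in F -> connect (adjacent F) (ends e).1 (ends e).2.
Proof.
move=> Fe; apply/connect1/existsP; exists e; rewrite Fe.
by case: (ends e) => u v /=; rewrite eqxx.
Qed.

(** The difference telescopes along a path, each edge contributing its own difference up to sign. *)
Lemma connect_difference (F : {set edge G}) u v w : connect (adjacent F) u v ->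
  single W u w - single W v w \in (\sum_(e in F) limg (difference e))%VS.
Proof.
case/connectP => p; elim: p u => [|u' p IHp] u /=.
  by move=> _ ->; rewrite subrr mem0v.
case/andP=> /existsP[e /andP[Fe eE]] pth vE.
rewrite -(subrK (single W u' w) (single W u w)) -addrA rpredD ?IHp //.
have eL := subvP (sumv_sup (Vs := fun e => limg (difference e)) e Fe (subvv _)).
have := eL _ (memv_img (difference e) (memvf w)); rewrite differenceE.
by case/orP: eE => /eqP-> //= ?; rewrite -opprB rpredN.
Qed.

Lemma card_partition_roots (T : finType) (P : pred T) (F : {set edge G})
    (h : T -> V) :
  #|[set x | P x]| =
  (\sum_(v | roots (adjacent F) v) #|[set x | P x & root (adjacent F) (h x) == v]|)%N.
Proof.
have cs := sym_connect_sym (adjacent_sym F).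
rewrite -sum1dep_card.
rewrite (partition_big (fun x => root (adjacent F) (h x)) (roots (adjacent F))) /=.
  by apply: eq_bigr => v _; rewrite sum1dep_card.
by move=> x _; apply: roots_root.
Qed.

(* Summing vectors over each connected component of [(V, F)] gives a map whose
   kernel is spanned by the spaces of the edges of [F]. *)
Lemma dim_rows_ge (F : {set edge G}) :
  (forall v, \dim (\sum_(r | rt r == v) <[c r]>) = #|[set r | rt r == v]|) ->
  (forall F' : {set edge G}, F' != set0 ->
     (#|F'| + #|[set r | rt r \in covered F']| + D <=
      D * #|covered F'| + \dim (\sum_(r | rt r \in covered F') <[c r]>))%N) ->
  (#|F| + #|J| <=
    \dim (\sum_r <[single W (rt r) (c r)]> + \sum_(e in F) limg (difference e)))%N.
Proof.
move=> indep count; set N := (_ + _)%VS.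
have cs := sym_connect_sym (adjacent_sym F).
set rho := root (adjacent F); pose p := push W rho.
pose B v := (\sum_(r | rho (rt r) == v) <[c r]>)%VS.
(* When the component sums of [x] vanish, moving every [x v] to the root of its component subtracts
   zero, and leaves a sum of differences between connected vertices. *)
have kerN : (lker p <= N)%VS.
  apply: subv_trans (addvSr _ _); apply/subvP => x; rewrite memv_ker pushE => /eqP x0.
  have -> : x = \sum_v (single W v (x v) - single W (rho v) (x v)).
    by rewrite sumrB x0 subr0 -ffun_sum_single.
  apply: rpred_sum => v _.
  by apply: connect_difference; apply: connect_root.
have dimp : (\dim (limg p) <= \sum_(v | roots (adjacent F) v) D)%N.
  rewrite (eq_bigr (fun=> \dim {:W})) => [|v _]; last by rewrite dimvf.
  rewrite -(dim_sum_single _ (fun=> fullv)); apply: dimvS.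
  apply/subvP => _ /memv_imgP[x _ ->]; rewrite pushE rpred_sum // => v _.
  have := sumv_sup (Vs := fun v : V => (single W v @: fullv)%VS) (rho v)
    (roots_root cs v) (subvv _).
  by move/subvP; apply; rewrite memv_img ?memvf.
have pN : (\sum_(v | roots (adjacent F) v) \dim (B v) <= \dim (p @: N))%N.
  rewrite -dim_sum_single; apply: dimvS; apply/subv_sumP => v _.
  rewrite limg_sum; apply/subv_sumP => r /eqP rv; rewrite limg_line -memvE -rv.
  rewrite -(push_single rho) memv_img // (subvP (addvSl _ _)) // memvE.
  exact: (sumv_sup r).
(* The counting inequality for the component rooted at [v], whose edge set is [Fv]. *)
have comp v : roots (adjacent F) v ->
    (#|[set e in F | rho (ends e).1 == v]| + #|[set r | true & rho (rt r) == v]| + D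
     <= D * #|[set u | true & rho u == v]| + \dim (B v))%N.
  move=> rv; set Fv := [set e in F | _].
  have nbr u u' : adjacent F u u' -> rho u = v -> u \in covered Fv.
    move=> /existsP[e /andP[Fe eE]] uv; rewrite inE; apply/existsP; exists e.
    rewrite inE Fe /=; have := connect_ends Fe; rewrite -(root_connect cs) -/rho.
    by case/orP: eE => /eqP-> /=; rewrite uv => /eqP e'; rewrite -?e' ?eqxx ?orbT.
  have path1 u u' : connect (adjacent F) u u' -> u != u' -> exists u'', adjacent F u u''.
    case/connectP => -[|u'' q] /=; first by move=> _ ->; rewrite eqxx.
    by case/andP=> uu _ _ _; exists u''.
  (* Without edges the component is the single vertex [v] and independence at [v] gives equality.
     Otherwise [Fv] covers exactly the component, and [count] applies. *)
  have [F0|Fn0] := eqVneq Fv set0.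
    have one : forall u, (rho u == v) = (u == v).
      move=> u; apply/eqP/eqP => [uv|->]; last exact/eqP.
      apply/eqP/negPn/negP => uv'; have : connect (adjacent F) u v.
        by rewrite -(root_connect cs) -/rho uv eq_sym.
      move=> /path1/(_ uv')[u' /nbr/(_ uv)]; rewrite F0 inE => /existsP[e].
      by rewrite inE.
    have -> : [set u | true & rho u == v] = [set v].
      by apply/setP => u; rewrite !inE one.
    have -> : [set r | true & rho (rt r) == v] = [set r | rt r == v].
      by apply/setP => r; rewrite !inE one.
    rewrite F0 cards0 cards1 muln1 addnC leq_add2l -indep /B.
    apply/eq_leq; congr (\dim _); apply: eq_bigl => r; exact/esym/one.
  have cov : forall u, (u \in covered Fv) = (rho u == v).
    move=> u; apply/idP/eqP => [|uv].
      rewrite inE => /existsP[e /andP[]]; rewrite inE => /andP[Fe /eqP ev].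
      have := connect_ends Fe; rewrite -(root_connect cs) -/rho ev => /eqP ev2.
      by case/orP => /eqP->.
    have /set0Pn[e] := Fn0; rewrite inE => /andP[Fe /eqP ev].
    have [ue|] := eqVneq u (ends e).1.
      rewrite ue inE; apply/existsP; exists e.
      by rewrite inE Fe ev !eqxx.
    have : connect (adjacent F) u (ends e).1.
      by rewrite -(root_connect cs) -/rho uv ev.
    by move=> /path1 h /h[u' /nbr]; apply.
  have := count Fv Fn0.
  rewrite (eq_bigl (fun r => rho (rt r) == v)) => [|r]; last exact: cov.
  have -> : covered Fv = [set u | true & rho u == v].
    by apply/setP => u; rewrite cov inE.
  by congr (_ + #|pred_of_set _| + _ <= _)%N; apply/setP => r; rewrite !inE.
have cF : #|F| = (\sum_(v | roots (adjacent F) v) #|[set e in F | rho (ends e).1 == v]|)%N.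
  rewrite -(card_partition_roots (mem F) F (fun e => (ends e).1)).
  by apply: eq_card => e; rewrite inE.
have cT (T : finType) (h : T -> V) : #|T| =
    (\sum_(v | roots (adjacent F) v) #|[set x | true & rho (h x) == v]|)%N.
  by rewrite -(card_partition_roots xpredT) -cardsT.
(* The sum over components is compared with [dim N = dim (lker p) + dim (p @: N)]: the kernel has
   dimension at least [D * #|V|] minus [D] per component, and the image at least the sum of the
   [\dim (B v)]. *)
have := leq_sum (index_enum V) comp.
rewrite !big_split /= -cF -(cT J) -big_distrr -(cT V id) /=.
have := limg_ker_dim p N; rewrite (capv_idPr kerN).
have := limg_ker_dim p fullv; rewrite capfv dimvf /= -/V.
have -> : dim {ffun V -> W} = (#|V| * D)%N by [].
rewrite -/(limg p).
move: dimp pN; rewrite mulnC.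
move: (\dim N) (\dim (lker p)) (\dim (limg p)) (\dim (p @: N)) (D * #|V|)%N.
move: (\sum_(i | roots _ i) D)%N (\sum_(v | roots (adjacent F) v) \dim (B v))%N.
by move: (#|F| + #|J|)%N; lia.
Qed.

End Graphs.

(** * Coordinate planes and the standard basis of the exterior power *)

Section Exterior.

Local Open Scope ring_scope.

Variables (R : realType) (k n : nat).

Definition kdelta (B : ksubset k n) : extpow R k n := [ffun A => (A == B)%:R].

Lemma extpow_sum_delta (w : extpow R k n) : w = \sum_B w B *: kdelta B.
Proof.
apply/ffunP => A; rewrite sum_ffunE (bigD1 A) //= !ffunE eqxx.
rewrite big1 => [|B BA]; first by rewrite addr0; apply/esym/mulr1.
by rewrite !ffunE eq_sym (negPf BA); apply: mulr0.
Qed.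

Lemma dim_extpow : dim (extpow R k n) = 'C(n, k).
Proof.
have -> : dim (extpow R k n) = (#|{: ksubset k n}| * 1)%N by [].
rewrite muln1 card_sig -[n in RHS]card_ord -card_draws.
by apply: eq_card => A; rewrite !inE.
Qed.

Definition coord_mx (B : ksubset k n) : 'M[R]_(k, n) :=
  \matrix_(i, j) (j == ksubset_nth B i)%:R.

Lemma ksubset_nth_inj (B : ksubset k n) : injective (ksubset_nth B).
Proof. by move=> i j /enum_val_inj/cast_ord_inj. Qed.

Lemma ksubset_nth_mem (A B : ksubset k n) :
  (forall i, ksubset_nth B i \in val A) -> A = B.
Proof.
move=> BA; apply/esym/val_inj/eqP; rewrite eqEcard (eqP (valP A)) (eqP (valP B)).
rewrite leqnn andbT; apply/subsetP => x Bx.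
have := BA (cast_ord (eqP (valP B)) (enum_rank_in Bx x)).
by rewrite /ksubset_nth cast_ordK enum_rankK_in.
Qed.

(** The minor at [B] is that of the identity matrix. For [A] different from [B], some element of [B]
    is missing from [A], and its row in the minor is zero. *)
Lemma wedge_coord_mx B : wedge (coord_mx B) = kdelta B.
Proof.
apply/ffunP => A; rewrite !ffunE; have [->|AB] := eqVneq A B.
  rewrite (_ : colsub _ _ = 1%:M) ?det1 //; apply/matrixP => i j.
  by rewrite !mxE (inj_eq (@ksubset_nth_inj B)) eq_sym.
have [/forallP/ksubset_nth_mem e|] :=
  boolP [forall i, ksubset_nth B i \in val A]; first by rewrite e eqxx in AB.
case/forallPn => i iA; rewrite (expand_det_row _ i) big1 // => j _.
rewrite !mxE; case: eqP => [e|_]; last by rewrite mul0r.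
by rewrite -e enum_valP in iA.
Qed.

Definition coord_space (B : ksubset k n) : {vspace 'rV[R]_n} :=
  <<[seq row i (coord_mx B) | i <- enum 'I_k]>>.

Fact dim_coord_space B : \dim (coord_space B) == k.
Proof.
have fr : free [tuple row i (coord_mx B) | i < k].
  apply/freeP => c; rewrite (eq_bigr (fun i => c i *: row i (coord_mx B))).
    move=> /(congr1 (fun v : 'rV_n => v 0 (ksubset_nth B _))) c0 i.
    move: (c0 i); rewrite summxE (bigD1 i) //= !mxE eqxx mulr1.
    rewrite big1 ?addr0 // => j ji; rewrite !mxE.
    by rewrite (inj_eq (@ksubset_nth_inj B)) eq_sym (negPf ji) mulr0.
  by move=> i _; rewrite -tnth_nth tnth_mktuple.
rewrite /coord_space (_ : map _ _ = [tuple row i (coord_mx B) | i < k]).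
  by rewrite (eqP fr) size_tuple.
by [].
Qed.

Definition coord_Gr B : Gr R k n :=
  exist (fun U => \dim U == k) (coord_space B) (dim_coord_space B).

(** The scalar absorbs the difference between the coordinate basis of the plane and the basis
    [vbasis] that [plucker] uses. *)
Lemma plucker_coord_Gr B :
  exists2 c : R, c != 0 & kdelta B = c *: plucker (coord_Gr B).
Proof. by rewrite -wedge_coord_mx; apply: wedge_plucker. Qed.

End Exterior.

(** * Nondegeneracy of the Hodge pairing *)

Section Pairing.

Local Open Scope ring_scope.

Variables (R : realType) (d : nat) (hd : (0 < d)%N).

Let W := extpow R 2 d.+1.

(** Positivity of [d] matters: for [d = 0] the truncated [d - 1] is 0 and the complement would have
    one element. *)
Lemma card_setC_ksubset (A : ksubset (d - 1) d.+1) : #|~: val A| == 2.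
Proof. by have := cardsC (val A); rewrite card_ord (eqP (valP A)); move: hd; lia. Qed.

Definition kcompl (A : ksubset (d - 1) d.+1) : ksubset 2 d.+1 :=
  exist (fun B : {set 'I_d.+1} => #|B| == 2) (~: val A) (card_setC_ksubset A).

Lemma card_setC_ksubset2 (B : ksubset 2 d.+1) : #|~: val B| == (d - 1)%N.
Proof. by have := cardsC (val B); rewrite card_ord (eqP (valP B)); lia. Qed.

Lemma kcompl_bij : bijective kcompl.
Proof.
exists (fun B => exist (fun A : {set 'I_d.+1} => #|A| == (d - 1)%N) _ (card_setC_ksubset2 B)) => A;
  by apply: val_inj; rewrite /= setCK.
Qed.

Definition hodge_sign (A : ksubset (d - 1) d.+1) : R :=
  (-1) ^+ inversions (~: val A) (val A).

Lemma pairingE (a : extpow R (d - 1) d.+1) (c : W) :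
  pairing a c = \sum_A a A * hodge_sign A * c (kcompl A).
Proof.
apply: eq_bigr => A _; rewrite /hodge ffunE -mulrA; congr (_ * (_ * _)).
by rewrite (insubT (fun B : {set 'I_d.+1} => #|B| == 2) (card_setC_ksubset A)).
Qed.

Fact pairing_is_linear (a : extpow R (d - 1) d.+1) :
  linear (pairing a : W -> R^o).
Proof.
move=> x c c'; rewrite !pairingE scaler_sumr -big_split /=.
apply: eq_bigr => A _; rewrite !ffunE mulrDr; congr (_ + _).
by rewrite mulrCA.
Qed.

HB.instance Definition _ (a : extpow R (d - 1) d.+1) :=
  GRing.isLinear.Build R W R^o *:%R (pairing a : W -> R^o) (pairing_is_linear a).

Lemma pairing0r (a : extpow R (d - 1) d.+1) : pairing a (0 : W) = 0.
Proof. exact: linear0. Qed.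

Lemma pairingBl (a a' : extpow R (d - 1) d.+1) (c : W) :
  pairing (a - a') c = pairing a c - pairing a' c.
Proof.
rewrite !pairingE -sumrB; apply: eq_bigr => A _.
by rewrite !ffunE !mulrBl.
Qed.

Lemma pairing_delta (a : extpow R (d - 1) d.+1) A :
  pairing a (kdelta R (kcompl A)) = a A * hodge_sign A.
Proof.
rewrite pairingE (bigD1 A) //= ffunE eqxx mulr1 big1 ?addr0 // => A' A'A.
by rewrite ffunE (inj_eq (bij_inj kcompl_bij)) (negPf A'A) mulr0.
Qed.

Lemma pairing_inj0 (a : extpow R (d - 1) d.+1) :
  (forall c : W, pairing a c = 0) -> a = 0.
Proof.
move=> a0; apply/ffunP => A; rewrite ffunE; have := a0 (kdelta R (kcompl A)).
by move/eqP; rewrite pairing_delta mulf_eq0 signr_eq0 orbF => /eqP.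
Qed.

(** In the standard bases the pairing is a signed permutation matrix, so the coordinates of [a] are
    the values of [psi] on basis vectors, corrected by a sign that is its own inverse. *)
Lemma pairing_surj (psi : {linear W -> R^o}) :
  exists a : extpow R (d - 1) d.+1, forall c : W, pairing a c = psi c.
Proof.
exists [ffun A => psi (kdelta R (kcompl A)) * hodge_sign A : R^o] => c.
rewrite [c]extpow_sum_delta !linear_sum; apply: eq_bigr => B _.
rewrite !linearZ; congr (_ * _); have [g _ gK] := kcompl_bij.
rewrite -(gK B); apply: etrans (pairing_delta _ _) _.
by rewrite ffunE -mulrA -expr2 sqrr_sign; apply: mulr1.
Qed.

End Pairing.

(** * Rigidity as a spanning property of the rows *)

Section Rigidity.

Import Defs.
Local Open Scope ring_scope.

Variables (R : realType) (d : nat) (hd : (0 < d)%N).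

Let W := extpow R 2 d.+1.

Implicit Types P : framework R d.

Definition bar_row P (e : edge (fgraph P)) : {ffun vertex (fgraph P) -> W} :=
  difference W e (plucker (bar e)).

Definition bbar_row P (r : bidx P) : {ffun vertex (fgraph P) -> W} :=
  single W (root r) (plucker (bbar r)).

Definition row_space P : {vspace {ffun vertex (fgraph P) -> W}} :=
  (\sum_e <[bar_row e]> + \sum_r <[@bbar_row P r]>)%VS.

(** The functional on the row vectors represented by [m]; by [pairing_surj] at each vertex, every
    linear functional arises so. *)
Definition work_fun P (m : vertex (fgraph P) -> extpow R (d - 1) d.+1)
    (x : {ffun vertex (fgraph P) -> W}) : R^o := \sum_v pairing (m v) (x v).

Fact work_fun_is_linear P (m : vertex (fgraph P) -> extpow R (d - 1) d.+1) :
  linear (work_fun m).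
Proof.
move=> a x y; rewrite /work_fun scaler_sumr -big_split /=.
by apply: eq_bigr => v _; rewrite !ffunE (pairing_is_linear hd).
Qed.

HB.instance Definition _ P m :=
  GRing.isLinear.Build R {ffun vertex (fgraph P) -> W} R^o *:%R (work_fun m)
    (@work_fun_is_linear P m).

Lemma work_fun_single P (m : vertex (fgraph P) -> extpow R (d - 1) d.+1) v w :
  work_fun m (single W v w) = pairing (m v) w.
Proof.
rewrite /work_fun (bigD1 v) //= singleE eqxx big1 ?addr0 // => u uv.
by rewrite singleE (negPf uv); apply: (pairing0r hd).
Qed.

Lemma infinitesimal_motionP P (m : vertex (fgraph P) -> extpow R (d - 1) d.+1) :
  infinitesimal_motion m <-> (row_space P <= lker (linfun (work_fun m)))%VS.
Proof.
have barE e : linfun (work_fun m) (bar_row e) =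
    pairing (m (ends e).1 - m (ends e).2) (plucker (bar e)).
  rewrite lfunE /bar_row differenceE linearB /= !work_fun_single.
  by rewrite (pairingBl hd).
have bbarE (r : bidx P) : linfun (work_fun m) (bbar_row r) =
    pairing (m (root r)) (plucker (bbar r)).
  by rewrite lfunE /bbar_row /= work_fun_single.
split=> [[me mr]|].
  rewrite subv_add; apply/andP; split; apply/subv_sumP => i _.
    by rewrite -memvE memv_ker barE me.
  by rewrite -memvE memv_ker bbarE mr.
rewrite subv_add => /andP[/subv_sumP Ke /subv_sumP Kr].
split=> [e|r]; first by have := Ke e isT; rewrite -memvE memv_ker barE => /eqP.
by have := Kr r isT; rewrite -memvE memv_ker bbarE => /eqP.
Qed.

(** Motions correspond to functionals vanishing on the row space, and a nonzero one exists exactly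
    when that space is proper. *)
Lemma rigidP P : infinitesimally_rigid P <-> row_space P = fullv.
Proof.
split=> [rig|full [m [/infinitesimal_motionP]]].
  apply/eqP; rewrite eqEsubv subvf /=; apply/negPn/negP => /subvPn[x _ xN].
  pose q := projv (row_space P); pose y := x - q x.
  have y0 : y != 0.
    by apply: contra xN; rewrite subr_eq0 => /eqP->; apply: memv_proj.
  have [v yv] : exists v, y v != 0.
    apply/existsP; apply: contraR y0 => /existsPn nz; apply/eqP/ffunP => v.
    by rewrite [RHS]ffunE; apply/eqP; rewrite -[_ == _]negbK; apply: nz.
  have [A yA] : exists A, y v A != 0.
    apply/existsP; apply: contraR yv => /existsPn nz; apply/eqP/ffunP => A.
    by rewrite [RHS]ffunE; apply/eqP; rewrite -[_ == _]negbK; apply: nz.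
  (* This functional vanishes on the row space, where [q] is the identity, and takes the nonzero
     value [y v A] at [x]. *)
  pose psi_fun (z : {ffun vertex (fgraph P) -> W}) : R^o := (z - q z) v A.
  have psi_lin : linear psi_fun.
    move=> a z z'; rewrite /psi_fun linearP opprD addrACA -scalerBr.
    by rewrite !ffunE.
  pose psi : {linear _ -> _} := HB.pack psi_fun (GRing.isLinear.Build _ _ _ _ _ psi_lin).
  have /fin_all_exists[m mE] u : exists a : extpow R (d - 1) d.+1,
      forall w : W, pairing a w = psi (single W u w).
    exact: (pairing_surj hd (psi \o single W u)%FUN).
  have workE z : work_fun m z = psi z.
    rewrite {2}[z]ffun_sum_single linear_sum /work_fun.
    by apply: eq_bigr => u _; rewrite mE.
  apply: rig; exists m; split.
    apply/infinitesimal_motionP/subvP => z zN; rewrite memv_ker lfunE /= workE.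
    by rewrite /= /psi_fun projv_id // subrr !ffunE.
  have [/existsP//|/existsPn m0] := boolP [exists u, m u != 0].
  case/eqP: yA; rewrite -[LHS]/(psi x) -workE /work_fun big1 // => u _.
  by move: (m0 u); rewrite negbK => /eqP->; rewrite (pairingE hd) big1 // => B _;
     rewrite ffunE !mul0r.
rewrite full => /subvP K [v /eqP]; apply; apply: (pairing_inj0 hd) => w.
have := K _ (memvf (single W v w)).
by rewrite memv_ker lfunE /= work_fun_single => /eqP.
Qed.

Lemma sum_sub_neq (vT : vectType R) (I : finType) (i0 : I) (U : I -> {vspace vT}) :
  (\sum_(i : {i | i != i0}) U (val i))%VS = (\sum_(i | i != i0) U i)%VS.
Proof. by symmetry; apply: (big_sub (fun i => i != i0)). Qed.

(** Edges and boundary bars are indexed together by a sum type, so that removing either kind drops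
    one index and [minimal_spanningP] applies. *)
Lemma minimally_rigidP P :
  minimally_infinitesimally_rigid P <->
  row_space P = fullv /\
  (#|edge (fgraph P)| + #|bidx P| = 'C(d.+1, 2) * #|vertex (fgraph P)|)%N.
Proof.
pose f (i : edge (fgraph P) + bidx P) :=
  match i with inl e => bar_row e | inr r => bbar_row r end.
have fE : row_space P = (\sum_i <[f i]>)%VS by rewrite big_sumType.
have fe e : row_space (remove_bar e) = (\sum_(i | i != inl e) <[f i]>)%VS.
  by rewrite big_sumType /= -(sum_sub_neq e (fun e' => <[f (inl e')]>%VS)).
have fr r : row_space (remove_bbar r) = (\sum_(i | i != inr r) <[f i]>)%VS.
  by rewrite big_sumType /= -(sum_sub_neq r (fun r' => <[f (inr r')]>%VS)).
have dU : dim {ffun vertex (fgraph P) -> W} = ('C(d.+1, 2) * #|vertex (fgraph P)|)%N.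
  by rewrite mulnC -(dim_extpow R).
rewrite -card_sum -dU.
split=> [[/rigidP full me mr]|[full card]].
  split=> //; rewrite fE in full; apply/(minimal_spanningP full) => -[e|r] fi.
    by apply: (me e); apply/rigidP; rewrite fe.
  by apply: (mr r); apply/rigidP; rewrite fr.
have := full; rewrite {1}fE => /minimal_spanningP[_ /(_ card) min].
split=> [|e|r]; first exact/rigidP.
  by move=> /rigidP; rewrite fe => /min.
by move=> /rigidP; rewrite fr => /min.
Qed.

End Rigidity.

(** * The two directions of the characterization *)

Section Main.

Local Open Scope ring_scope.

Variables (R : realType) (d : nat) (hd : (0 < d)%N) (G : graph) (J : finType).
Variables (rt : J -> vertex G) (b0 : J -> Gr R 2 d.+1).

Let W := extpow R 2 d.+1.
Let D := 'C(d.+1, 2).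
Let c r : W := plucker (b0 r).

Lemma dim_bfamily (A : {set J}) :
  \dim <<bfamily b0 A>> = \dim (\sum_(r in A) <[c r]>).
Proof. by rewrite /bfamily span_image. Qed.

Lemma free_bfamily (A : {set J}) :
  free (bfamily b0 A) = (\dim (\sum_(r in A) <[c r]>) == #|A|).
Proof. by rewrite /free dim_bfamily size_image. Qed.

Lemma covered_neq0 (F : {set edge G}) : F != set0 -> covered F != set0.
Proof.
case/set0Pn => e Fe; apply/set0Pn; exists (ends e).1.
by rewrite inE; apply/existsP; exists e; rewrite Fe eqxx.
Qed.

Let f (b : edge G -> Gr R 2 d.+1) (i : edge G + J) : {ffun vertex G -> W} :=
  match i with
  | inl e => difference W e (plucker (b e))
  | inr r => single W (rt r) (c r)
  end.

(** The rows form a basis, so every subfamily is independent: the boundary rows at [v] give (1), and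
    those of [F] and its boundary bars, bounded by [dim_rows_le], give (2). *)
Lemma count_of_rigid (b : edge G -> Gr R 2 d.+1) :
  minimally_infinitesimally_rigid (Framework rt b b0) ->
  [/\ (forall v, free (bfamily b0 [set r | rt r == v])),
      (forall F : {set edge G}, F != set0 ->
         (#|F| + #|[set r | rt r \in covered F]| <=
            D * #|covered F| - D
            + \dim <<bfamily b0 [set r | rt r \in covered F]>>)%N)
    & (#|edge G| + #|J| = D * #|vertex G|)%N].
Proof.
case/(minimally_rigidP hd) => full card.
have fF : (\sum_i <[f b i]>)%VS = fullv by rewrite -full big_sumType.
have dF : #|{: edge G + J}| = dim {ffun vertex G -> W}.
  by rewrite card_sum [LHS]card mulnC -(dim_extpow R).
split=> // [v|F F0].
  rewrite free_bfamily -(dim_limg_single v) limg_sum.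
  have := dim_subfamily (fun i => if i is inr r then rt r == v else false) fF dF.
  rewrite -sum1dep_card !big_sumType /= !big_pred0_eq add0v add0n sum1dep_card.
  move=> <-; apply/eqP; congr (\dim _); apply: eq_big => r; rewrite inE //.
  by move/eqP->; rewrite limg_line.
have := dim_subfamily (fun i => match i with
  inl e => e \in F | inr r => rt r \in covered F end) fF dF.
rewrite -sum1dep_card !big_sumType /= sum1_card sum1dep_card => e.
have := dim_rows_le rt c (fun e => plucker (b e)) (covered_neq0 F0) (subxx _).
rewrite e dim_bfamily dim_extpow -/D.
(* A covered vertex exists, so the natural-number subtraction of [D] is not truncated. *)
have : (0 < #|covered F|)%N by rewrite card_gt0 covered_neq0.
under [in X in _ -> _ -> X]eq_bigl do rewrite inE.
set x := #|covered F|; case: x => // x _; rewrite mulnS; lia.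
Qed.

Lemma rigid_of_count :
  (forall v, free (bfamily b0 [set r | rt r == v])) ->
  (forall F : {set edge G}, F != set0 ->
     (#|F| + #|[set r | rt r \in covered F]| <=
        D * #|covered F| - D
        + \dim <<bfamily b0 [set r | rt r \in covered F]>>)%N) ->
  (#|edge G| + #|J| = D * #|vertex G|)%N ->
  exists b, minimally_infinitesimally_rigid (Framework rt b b0).
Proof.
move=> indep count card; pose B := (\sum_r <[single W (rt r) (c r)]>)%VS.
pose A (e : edge G) := limg (difference W e).
have ge (F : {set edge G}) : (#|F| + #|J| <= \dim (B + \sum_(e in F) A e))%N.
  apply: (dim_rows_ge (rt := rt) (c := c)) => [v|F' F0].
    move: (indep v); rewrite free_bfamily => /eqP <-.
    by congr (\dim _); apply: eq_bigl => r; rewrite inE.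
  rewrite dim_extpow -/D; move: (count F' F0); rewrite dim_bfamily.
  under eq_bigl do rewrite inE.
  have : (0 < #|covered F'|)%N by rewrite card_gt0 covered_neq0.
  set x := #|covered F'|; case: x => // x _; rewrite mulnS; lia.
(* Taking [F] empty in [ge] shows that the boundary rows are independent, which turns [ge] into
   Hall's condition relative to [B]. *)
have dB : \dim B = #|J|.
  apply/eqP; rewrite eqn_leq; apply/andP; split.
    by have := dim_sum_lines (fun r => single W (rt r) (c r)) xpredT; rewrite cardsE.
  by have := ge set0; rewrite cards0 big_set0 addv0.
have hA : hall B A by move=> F; rewrite dB.
have /card_gt0P[x0 _] : (0 < #|{: ksubset 2 d.+1}|)%N.
  have := dim_extpow R 2 d.+1; rewrite /dim /= muln1 => ->.
  by rewrite bin_gt0.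
(* Up to nonzero scalars the coordinate planes give the standard basis of [W], so their rows at [e]
   span [A e]. *)
have [|x hx] := rado (f := fun e X => difference W e (plucker (coord_Gr R X))) x0 _ hA.
  move=> e N xN; apply/subvP => _ /memv_imgP[w _ ->].
  rewrite [w]extpow_sum_delta linear_sum rpred_sum // => X _.
  have [a _ ->] := plucker_coord_Gr R X.
  by rewrite !linearZ !memvZ ?xN.
exists (fun e => coord_Gr R (x e)); apply/(minimally_rigidP hd); split=> //.
apply/eqP; rewrite eqEdim subvf /= dimvf.
have -> : dim {ffun vertex G -> W} = (D * #|vertex G|)%N.
  by rewrite mulnC /D -(dim_extpow R).
(* Hall's condition for the set of all edges gives the row space dimension at least
   [#|edge G| + #|J|], which is the full dimension by [card]. *)
rewrite -card -dB -cardsT (leq_trans (hx _)) // addvC eq_leq //.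
by congr (\dim (_ + _)); apply: eq_bigl => e; rewrite inE.
Qed.

End Main.

Theorem theorem6p1 (R : realType) (d : nat) (hd : (0 < d)%N) (G : graph)
    (J : finType) (rt : J -> vertex G) (b0 : J -> Gr R 2 d.+1) :
  let D := 'C(d.+1, 2) in
  (exists b : edge G -> Gr R 2 d.+1,
     minimally_infinitesimally_rigid (Framework rt b b0)) <->
  [/\ (forall v : vertex G, free (bfamily b0 [set r | rt r == v])),
      (forall F : {set edge G}, F != set0 ->
         let RF := [set r | rt r \in covered F] in
         (#|F| + #|RF| <=
            D * #|covered F| - D + \dim <<bfamily b0 RF>>%VS)%N)
    & (#|edge G| + #|J| = D * #|vertex G|)%N].
Proof.
split=> [[b /(count_of_rigid hd)]|[indep count card]] //.
exact: rigid_of_count.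
Qed.
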